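(* Let $S\subset\mathbb{R}^2$ be a finite set of sites. Proximal Delaunay triangulation regions of $S$ are convex polygons; that is, if $\mathcal{D}_1,\mathcal{D}_2$ are Delaunay triangulation regions of $S$ having at least one vertex in common, then each of $\mathcal{D}_1,\mathcal{D}_2$ is a convex polygon.
   Context: For $p\in S$, the Voronoi region of $p$ is $V_p=\{x\in\mathbb{R}^2:\|x-p\|\le\|x-q\|\text{ for all }q\in S\}$. For $p,q\in S$, the straight segment $\overline{pq}$ is a Delaunay edge if and only if $V_p$ and $V_q$ intersect along a common line segment. A triangle $\bigtriangleup(pqr)$ with vertices $p,q,r\in S$ is a Delaunay triangle provided its edges are Delaunay edges. Two Delaunay triangles are strongly near if they have a common edge. A Delaunay triangulation region $\mathcal{D}$ is a collection of Delaunay triangles such that every pair of triangles in the collection is strongly near (it is a triangulation of a finite set of points whose triangles are pairwise strongly near). Delaunay triangulation regions are called proximal if they have at least one vertex in common. As a planar set, a region is identified with the union of its triangles. A set $A$ is convex if $\alpha A+(1-\alpha)A\subset A$ for each $\alpha\in[0,1]$. *)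

(* Defs.v *)
From HB Require Import structures.
From mathcomp Require Import all_boot all_order all_algebra.
From mathcomp Require Import all_classical all_reals all_analysis.

Set Implicit Arguments.
Unset Strict Implicit.
Unset Printing Implicit Defensive.

Import Order.TTheory GRing.Theory Num.Theory.

Local Open Scope classical_set_scope.
Local Open Scope ring_scope.

Section Delaunay.
Variable R : realType.
Local Notation point := 'rV[R]_2.
Implicit Types (p q r s x : point) (S P A T : set point).
Implicit Types D : set (set point).

(* The library norm on row vectors is the max norm, hence this definition. *)
Definition enorm x : R := Num.sqrt (\sum_i x ord0 i ^+ 2).

Definition segment p q : set point :=
  [set x | exists2 t : R, 0 <= t <= 1 & x = (1 - t) *: p + t *: q].

Definition conv_hull A : set point := smallest (@convex_set R point) A.

Definition noncollinear p q r : Prop := row_free (col_mx (q - p) (r - p)).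

Definition voronoi S p : set point :=
  [set x | forall q, S q -> enorm (x - p) <= enorm (x - q)].

(* The common part of two Voronoi regions has to contain a nondegenerate
   segment; it may be unbounded, as it is for edges on the hull of S. *)
Definition delaunay_edge S p q : Prop :=
  [/\ S p, S q, p != q &
    exists a b, a != b /\ segment a b `<=` voronoi S p `&` voronoi S q].

(* A triangle is encoded by its set of vertices; as a planar set it is the
   convex hull of that set. *)
Definition delaunay_triangle S T : Prop :=
  exists p q r, [/\ T = [set p; q; r], noncollinear p q r,
    delaunay_edge S p q, delaunay_edge S q r & delaunay_edge S r p].

Definition triangle_edge T p q : Prop := [/\ p != q, T p & T q].

Definition strongly_near T1 T2 : Prop :=
  exists p q, triangle_edge T1 p q /\ triangle_edge T2 p q.

Definition vertices D : set point := \bigcup_(T in D) T.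

Definition edge D p q : Prop := exists2 T, D T & triangle_edge T p q.

Definition carrier D : set point := \bigcup_(T in D) conv_hull T.

(* Two distinct edges of a plane straight-line graph meet at most in common
   endpoints. *)
Definition noncrossing p q r s : Prop :=
  segment p q `&` segment r s `<=` [set p; q] `&` [set r; s].

(* A triangulation of P is a maximal plane straight-line graph with vertex
   set P, given by the collection D of its bounded faces. *)
Definition triangulation P D : Prop :=
  [/\ vertices D = P,
      forall p q r s, edge D p q -> edge D r s ->
        [set p; q] <> [set r; s] -> noncrossing p q r s,
      forall p q, P p -> P q -> p != q ->
        (forall r s, edge D r s -> noncrossing p q r s) -> edge D p q &
      forall p q r, edge D p q -> edge D q r -> edge D r p ->
        D [set p; q; r] <->
        P `&` conv_hull [set p; q; r] `<=` [set p; q; r]].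

Definition delaunay_region S D : Prop :=
  [/\ forall T, D T -> delaunay_triangle S T,
      forall T1 T2, D T1 -> D T2 -> strongly_near T1 T2 &
      exists2 P, finite_set P & triangulation P D].

Definition proximal D1 D2 : Prop := vertices D1 `&` vertices D2 !=set0.

Definition convex_polygon A : Prop :=
  @convex_set R point A /\
  exists V, [/\ finite_set V,
    exists p q r, [/\ V p, V q, V r & noncollinear p q r] &
    A = conv_hull V].

End Delaunay.

(* Main.v *)
Require Import Defs.
From HB Require Import structures.
From mathcomp Require Import all_boot all_order all_algebra.
From mathcomp Require Import all_classical all_reals all_analysis.
From mathcomp Require Import ring lra.

Set Implicit Arguments.
Unset Strict Implicit.
Unset Printing Implicit Defensive.

Import Order.TTheory GRing.Theory Num.Theory.

Local Open Scope classical_set_scope.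
Local Open Scope ring_scope.

Local Notation point R := 'rV[R]_2.

(** Triangles that pairwise share an edge leave little room.  Let D be such a
    triangulation with at least two triangles, say xyz and xyw.  Planarity
    forces z and w to lie on opposite sides of the line xy
    ([opposite_sides]), so an edge carries at most two triangles
    ([at_most_two_triangles]).  A triangle with a vertex u outside
    {x, y, z, w} would have to share with xyz and with xyw the very edge xy,
    and would be a third triangle on it; hence the vertices are exactly
    x, y, z, w ([at_most_four_vertices]).

    It remains to see that the triangles cover the convex hull of these four
    points.  Write w = a x + b y + c z with a + b + c = 1; opposite sides means
    c < 0.  This is an affine dependence with coefficients -a, -b, -c, 1, and
    the exchange argument in the proof of Caratheodory's theorem shows that
    the hull is the union of the triangles obtained by omitting one point
    whose coefficient is positive ([conv_hull_exchange]).  Omitting w or z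
    leaves xyz or xyw, which belong to D.  Omitting x matters only if a < 0;
    then the quadrilateral is not convex at y, no edge can cross the segment
    zw, so maximality makes zw an edge and yzw a triangle of D
    ([ear_triangle]).  The case of y is symmetric.

    So the carrier is the convex hull of the vertex set, also when D has a
    single triangle.  All positions are measured with the signed area
    [orient] and the barycentric coordinates it yields. *)

(** * Signed area and barycentric coordinates *)

(** Twice the signed area of the triangle: its sign tells on which side of
    the line pq the point r lies. *)
Definition orient (R : realType) (p q r : point R) : R :=
  (q ord0 0 - p ord0 0) * (r ord0 1 - p ord0 1) -
  (q ord0 1 - p ord0 1) * (r ord0 0 - p ord0 0).

Lemma det_mx2 (R : realType) (A : 'M[R]_2) :
  \det A = A 0 0 * A 1 1 - A 0 1 * A 1 0.
Proof.
rewrite (expand_det_row _ 0) !big_ord_recl big_ord0 /cofactor !det_mx11 !mxE.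
rewrite /= expr0 expr1 mul1r mulN1r addr0 mulrN.
by congr (_ * A _ _ - A _ _ * A _ _); apply/val_inj.
Qed.

Lemma noncollinearE (R : realType) (p q r : point R) :
  noncollinear p q r <-> orient p q r != 0.
Proof.
rewrite /noncollinear row_free_unit unitmxE unitfE.
have up j : col_mx (q - p) (r - p) (0 : 'I_2) j = (q - p) ord0 j.
  have -> : (0 : 'I_2) = lshift 1 (ord0 : 'I_1) by exact/val_inj.
  exact: col_mxEu.
have down j : col_mx (q - p) (r - p) (1 : 'I_2) j = (r - p) ord0 j.
  have -> : (1 : 'I_2) = rshift 1 (ord0 : 'I_1) by exact/val_inj.
  exact: col_mxEd.
by rewrite (det_mx2 (col_mx (q - p) (r - p))) !up !down !mxE.
Qed.

Lemma pointP (R : realType) (x y : point R) :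
  x ord0 0 = y ord0 0 -> x ord0 1 = y ord0 1 -> x = y.
Proof.
move=> e0 e1; apply/rowP => i; case: (unliftP ord0 i) => [j ->|->//].
by rewrite (ord1 j) (_ : lift _ _ = 1) //; apply/val_inj.
Qed.

(** Cramer's rule.  Only the third coordinate is made explicit: it compares
    the sides of the line pq on which x and r lie. *)
Lemma orient_barycentric (R : realType) (p q r x : point R) :
  orient p q r != 0 ->
  exists a b c, [/\ a + b + c = 1, c = orient p q x / orient p q r &
    x = a *: p + b *: q + c *: r].
Proof.
move=> npqr; exists (orient q r x / orient p q r).
exists (orient r p x / orient p q r); exists (orient p q x / orient p q r).
have e : orient q r x + orient r p x + orient p q x = orient p q r.
  by rewrite /orient; ring.
split=> //; first by rewrite -!mulrDl e divff.
by apply: pointP; rewrite !mxE /orient; field; rewrite /orient in npqr.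
Qed.

Lemma orient_affine (R : realType) (u v p q r : point R) (a b c : R) :
  a + b + c = 1 ->
  orient u v (a *: p + b *: q + c *: r) =
  a * orient u v p + b * orient u v q + c * orient u v r.
Proof.
move=> e; have -> : a = 1 - b - c by lra.
by rewrite /orient !mxE; ring.
Qed.

Lemma orientC (R : realType) (p q r : point R) : orient q p r = - orient p q r.
Proof. by rewrite /orient; ring. Qed.

Lemma orient_rot (R : realType) (p q r : point R) : orient q r p = orient p q r.
Proof. by rewrite /orient; ring. Qed.

Lemma orient_id (R : realType) (p q : point R) : orient p q q = 0.
Proof. by rewrite /orient; ring. Qed.

Lemma orient_neq (R : realType) (p q r : point R) :
  orient p q r != 0 -> [/\ p != q, q != r & r != p].
Proof.
move=> h; split; apply: contraNneq h => ->.
- by rewrite -2!orient_rot orient_id.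
- by rewrite orient_id.
- by rewrite -orient_rot orient_id.
Qed.

(** * Convex hulls of finite families *)

Lemma convex_set_pair (R : realType) (C : set (point R)) (a b : R) x y :
  @convex_set R (point R) C -> C x -> C y -> 0 <= a -> 0 <= b -> a + b = 1 ->
  C (a *: x + b *: y).
Proof.
move=> cC Cx Cy a0 b0 ab; have a1 : a <= 1 by lra.
have -> : b = 1 - a by lra.
have := cC x y (Itv01 a0 a1); rewrite !inE; exact.
Qed.

(** Asking for membership in C only where the weight is nonzero lets the
    weights themselves select a subfamily. *)
Lemma convex_set_sum (R : realType) (C : set (point R)) (I : finType)
    (a : I -> R) (f : I -> point R) :
  @convex_set R (point R) C -> (forall i, 0 <= a i) -> \sum_i a i = 1 ->
  (forall i, a i != 0 -> C (f i)) -> C (\sum_i a i *: f i).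
Proof.
move=> cC a0 a1 Cf.
(* K c v: v has total weight c and its normalization lies in C.  Unlike
   plain membership, this survives adding one term at a time. *)
pose K (c : R) (v : point R) :=
  [/\ 0 <= c, c = 0 -> v = 0 & 0 < c -> C (c^-1 *: v)].
suff : K (\sum_i a i) (\sum_i a i *: f i).
  by rewrite a1 => -[_ _ /(_ ltr01)]; rewrite invr1 scale1r.
elim/big_ind2 : _ => [|x v y w [v0 vx Cx] [w0 wy Cy]|i _].
- by split=> //; rewrite ltxx.
- split; [exact: addr_ge0| |].
    by move=> /eqP; rewrite paddr_eq0// => /andP[/eqP/vx -> /eqP/wy ->]; rewrite addr0.
  move=> vw0; have [ve|vn] := eqVneq v 0.
    by move: vw0; rewrite ve (vx ve) !add0r; exact: Cy.
  have [we|wn] := eqVneq w 0.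
    by move: vw0; rewrite we (wy we) !addr0; exact: Cx.
  have vp : 0 < v by rewrite lt0r vn.
  have wp : 0 < w by rewrite lt0r wn.
  rewrite (_ : _ *: _ =
      (v / (v + w)) *: (v^-1 *: x) + (w / (v + w)) *: (w^-1 *: y)).
    apply: convex_set_pair => //; [exact: Cx|exact: Cy|..].
    + by rewrite divr_ge0// ltW.
    + by rewrite divr_ge0// ltW.
    + by rewrite -mulrDl divff// gt_eqF.
  rewrite scalerDr !scalerA.
  by congr (_ *: _ + _ *: _); field; rewrite ?vn ?wn gt_eqF.
- split=> // [->|ai0]; first by rewrite scale0r.
  by rewrite scalerA mulVf ?gt_eqF// scale1r; apply: Cf; rewrite gt_eqF.
Qed.

Lemma convex_conv_hull (R : realType) (A : set (point R)) :
  @convex_set R (point R) (conv_hull A).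
Proof.
move=> x y l; rewrite !inE => hx hy C [cC AC].
have /(_ x y l) := cC; rewrite !inE; apply; [exact: hx|exact: hy].
Qed.

Lemma conv_hull_sub (R : realType) (A B : set (point R)) :
  A `<=` B -> conv_hull A `<=` conv_hull B.
Proof. by move=> AB; apply: sub_smallest2r => //; exact: convex_conv_hull. Qed.

Lemma sub_conv_hull (R : realType) (A : set (point R)) : A `<=` conv_hull A.
Proof. exact: sub_gen_smallest. Qed.

Lemma conv_hull_range (R : realType) (I : finType) (f : I -> point R) v :
  conv_hull (range f) v ->
  exists a : I -> R,
    [/\ forall i, 0 <= a i, \sum_i a i = 1 & v = \sum_i a i *: f i].
Proof.
move: v; apply: smallest_sub; last first.
  move=> _ [i _ <-]; exists (fun j => (j == i)%:R); split.
  - by move=> j; rewrite ler0n.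
  - by rewrite (bigD1 i)//= eqxx big1 ?addr0// => j /negbTE ->.
  - rewrite (bigD1 i)//= eqxx scale1r big1 ?addr0// => j /negbTE ->.
    by rewrite scale0r.
move=> x y l; rewrite !inE => -[a [a0 a1 ->]] [b [b0 b1 ->]].
exists (fun i => l%:num * a i + (1 - l%:num) * b i); split.
- by move=> i; rewrite addr_ge0 ?mulr_ge0 ?subr_ge0.
- by rewrite big_split -!mulr_sumr /= a1 b1 !mulr1 subrKC.
- rewrite /conv/= !scaler_sumr -big_split/=; apply: eq_bigr => i _.
  transitivity (l%:num *: (a i *: f i) + (1 - l%:num) *: (b i *: f i)) => //.
  by rewrite !scalerA -scalerDl.
Qed.

(** Moving the weights of v along the dependence l leaves v unchanged; moving
    as far as the weights stay nonnegative makes one of them vanish, and only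
    a weight with positive l can be the first to do so. *)
Lemma conv_hull_exchange (R : realType) (I : finType) (f : I -> point R)
    (l : I -> R) (i0 : I) v :
  \sum_i l i = 0 -> \sum_i l i *: f i = 0 -> 0 < l i0 ->
  conv_hull (range f) v -> exists2 i, 0 < l i & conv_hull (f @` [set~ i]) v.
Proof.
move=> l0 lf0 li0 /conv_hull_range [a [a0 a1 ->]].
case: (@Order.TotalTheory.arg_minP _ _ _ i0 (fun i => 0 < l i)
  (fun i => a i / l i) li0) => i li imin; exists i => //.
pose t := a i / l i.
have t0 : 0 <= t by rewrite divr_ge0// ltW.
pose b j := a j - t * l j.
have -> : \sum_j a j *: f j = \sum_j b j *: f j.
  under [RHS]eq_bigr do rewrite scalerBl -scalerA.
  by rewrite sumrB -scaler_sumr lf0 scaler0 subr0.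
apply: convex_set_sum.
- exact: convex_conv_hull.
- move=> j; rewrite subr_ge0; have [lj|lj] := ltP 0 (l j).
    by rewrite -ler_pdivlMr//; exact: imin.
  by apply: le_trans (a0 j); rewrite mulr_ge0_le0.
- by rewrite sumrB -mulr_sumr l0 mulr0 subr0.
- move=> j bj; apply: sub_conv_hull; exists j => //= ji.
  by move: bj; rewrite /b ji /t divfK ?subrr ?eqxx// gt_eqF.
Qed.

(** Lets results on finite families apply to explicit vertex sets. *)
Lemma range_tuple3 (T : Type) (x y z : T) :
  range (tnth [tuple x; y; z]) = [set x; y; z].
Proof.
apply/seteqP; split => u /=.
  by move=> [[[|[|[|]]]//= ?] _ <-]; rewrite /tnth /=; tauto.
move=> [[]|] ->.
- by exists (inord 0) => //; rewrite /tnth /= inordK.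
- by exists (inord 1) => //; rewrite /tnth /= inordK.
- by exists (inord 2) => //; rewrite /tnth /= inordK.
Qed.

Lemma range_tuple4 (T : Type) (x y z w : T) :
  range (tnth [tuple x; y; z; w]) = [set x; y; z; w].
Proof.
apply/seteqP; split => u /=.
  by move=> [[[|[|[|[|]]]]//= ?] _ <-]; rewrite /tnth /=; tauto.
move=> [[[]|]|] ->.
- by exists (inord 0) => //; rewrite /tnth /= inordK.
- by exists (inord 1) => //; rewrite /tnth /= inordK.
- by exists (inord 2) => //; rewrite /tnth /= inordK.
- by exists (inord 3) => //; rewrite /tnth /= inordK.
Qed.

Lemma conv_hull3P (R : realType) (x y z v : point R) :
  conv_hull [set x; y; z] v <->
  exists a b c, [/\ 0 <= a, 0 <= b, 0 <= c, a + b + c = 1 &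
    v = a *: x + b *: y + c *: z].
Proof.
split.
  rewrite -range_tuple3 => /conv_hull_range[a [a0 a1 ->]].
  move: a1; rewrite !big_ord_recl !big_ord0 !addr0 !addrA !(tnth_nth 0) /= => a1.
  by do 3 eexists; split; try exact: a1; try exact: a0.
move=> [a [b [c [a0 b0 c0 s ->]]]].
have := @convex_set_sum R (conv_hull [set x; y; z]) _ (tnth [tuple a; b; c])
  (tnth [tuple x; y; z]) (@convex_conv_hull _ _).
rewrite !big_ord_recl !big_ord0 !addr0 !addrA !(tnth_nth 0) /=; apply => //.
  by move=> [[|[|[|]]]//= ?]; rewrite /tnth /=.
by move=> i _; apply: sub_conv_hull; rewrite -range_tuple3; exists i.
Qed.

(** * Planar triangulations *)

Definition nondegenerate (R : realType) (T : set (point R)) : Prop :=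
  exists p q r, T = [set p; q; r] /\ orient p q r != 0.

(** A triangle can be rewritten as starting with any two of its vertices, so
    that a shared edge can always be called xy. *)
Lemma nondegenerate_third (R : realType) (T : set (point R)) x y :
  nondegenerate T -> x != y -> T x -> T y ->
  exists2 z, T = [set x; y; z] & orient x y z != 0.
Proof.
move=> [p [q [r [-> pqr]]]] /eqP xy.
have qrp : orient q r p != 0 by rewrite orient_rot.
have rpq : orient r p q != 0 by rewrite orient_rot.
have qpr : orient q p r != 0 by rewrite orientC oppr_eq0.
have rqp : orient r q p != 0 by rewrite orientC oppr_eq0.
have prq : orient p r q != 0 by rewrite orientC oppr_eq0.
by move=> [[]|] ex [[]|] ey; (try by case: xy; rewrite ex ey); rewrite ex ey;
  [exists r|exists q|exists r|exists p|exists q|exists p] => //;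
  apply/seteqP; split=> u /=; tauto.
Qed.

Section Triangulation.
Variables (R : realType) (P : set (point R)) (D : set (set (point R))).
Hypothesis triPD : triangulation P D.
Implicit Types p q r x y z w : point R.

Lemma triangulation_edges p q r : D [set p; q; r] -> orient p q r != 0 ->
  [/\ edge D p q, edge D q r & edge D r p].
Proof.
by move=> Dpqr /orient_neq[pq qr rp]; split; exists [set p; q; r] => //;
  split=> //=; tauto.
Qed.

Lemma edge_sym p q : edge D p q -> edge D q p.
Proof. by move=> [T DT [pq Tp Tq]]; exists T => //; split; rewrite // eq_sym. Qed.

Lemma edge_vertices p q : edge D p q -> [/\ p != q, P p & P q].
Proof.
by case: triPD => <- _ _ _ [T DT [pq Tp Tq]]; split=> //; exists T.
Qed.

Lemma triangle_empty p q r x : D [set p; q; r] -> orient p q r != 0 ->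
  P x -> conv_hull [set p; q; r] x -> [set p; q; r] x.
Proof.
move=> Dpqr npqr Px hx; have [pq qr rp] := triangulation_edges Dpqr npqr.
by case: triPD => _ _ _ /(_ p q r pq qr rp)[/(_ Dpqr) + _]; apply; split.
Qed.

(** The equation reads w - a x = b y + c z with nonnegative coefficients of
    equal sums on both sides: once divided by 1 - a, it exhibits a common
    point of the edges xw and yz, which share no endpoint. *)
Lemma no_crossing_edges x y z w (a b c : R) :
  edge D x w -> edge D y z ->
  y != x -> z != x -> y != w -> z != w ->
  a + b + c = 1 -> w = a *: x + b *: y + c *: z ->
  a < 0 -> 0 <= b -> 0 <= c -> False.
Proof.
move=> xw yz /eqP yx /eqP zx /eqP yw /eqP zw s we a0 b0 c0.
have ne : [set x; w] <> [set y; z].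
  by move=> e; have [/esym|/esym] : [set y; z] x by rewrite -e; left.
case: triPD => _ /(_ _ _ _ _ xw yz ne) cr _ _.
have a1 : 0 < 1 - a by lra.
have t0 : 0 <= (1 - a)^-1 <= 1 by rewrite invr_ge0 invf_le1//; lra.
have t'0 : 0 <= c / (1 - a) <= 1.
  by rewrite divr_ge0 ?ler_pdivrMr ?mul1r//; lra.
have be : b = 1 - a - c by lra.
pose m := (1 - (1 - a)^-1) *: x + (1 - a)^-1 *: w.
have /cr [mxw myz] : (segment x w `&` segment y z) m.
  split; first by exists (1 - a)^-1.
  exists (c / (1 - a)) => //; rewrite /m we be.
  by apply: pointP; rewrite !mxE; field; rewrite gt_eqF.
by case: mxw myz => -> [/esym|/esym].
Qed.

(** In barycentric coordinates w = a x + b y + c z, the case c > 0 is excluded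
    by the signs of a and b: if both are negative, z is in the triangle xyw;
    if both are nonnegative, w is in xyz; otherwise xw crosses yz or yw
    crosses zx. *)
Lemma opposite_sides x y z w :
  D [set x; y; z] -> D [set x; y; w] -> z != w ->
  orient x y z != 0 -> orient x y w != 0 ->
  orient x y w / orient x y z < 0.
Proof.
move=> Dz Dw zw nz nw.
have [xy yz zx] := triangulation_edges Dz nz.
have [_ yw wx] := triangulation_edges Dw nw.
have [xney ynez znex] := orient_neq nz; have [_ ynew wnex] := orient_neq nw.
have [_ Px Py] := edge_vertices xy.
have [_ _ Pz] := edge_vertices yz; have [_ _ Pw] := edge_vertices yw.
have [a [b [c [s ce we]]]] := orient_barycentric w nz.
rewrite -ce ltNge; apply/negP => c0.
have {}c0 : 0 < c by rewrite lt0r c0 ce mulf_neq0 ?invr_eq0.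
have [a0|a0] := ltP a 0; have [b0|b0] := ltP b 0.
- have /(triangle_empty Dw nw Pz) : conv_hull [set x; y; w] z.
    (* Solve w = a x + b y + c z for z. *)
    apply/conv_hull3P; exists (- a / c), (- b / c), c^-1.
    have cn : c != 0 by rewrite gt_eqF.
    split; rewrite ?divr_ge0 ?invr_ge0 ?oppr_ge0 ?(ltW a0) ?(ltW b0) ?(ltW c0)//.
      by rewrite -{3}[c^-1]mul1r -!mulrDl (_ : - a - b + 1 = c) ?divff//; lra.
    by rewrite we; apply: pointP; rewrite !mxE; field.
  by move=> [[]|] e; move: zw ynez znex; rewrite e eqxx.
- apply: (no_crossing_edges (edge_sym wx) yz _ _ _ _ s we) => //.
  + by rewrite eq_sym.
  + exact: ltW.
- apply: (no_crossing_edges yw (edge_sym zx) _ _ _ _ (_ : b + a + c = 1)) => //.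
  + by rewrite eq_sym.
  + by rewrite eq_sym.
  + by lra.
  + by rewrite we [a *: x + _]addrC.
  + exact: ltW.
- have /(triangle_empty Dz nz Pw) : conv_hull [set x; y; z] w.
    by apply/conv_hull3P; exists a, b, c; split=> //; exact: ltW.
  by move=> [[]|] e; move: zw ynew wnex; rewrite e eqxx.
Qed.

(** Three points cannot be pairwise on opposite sides of a line. *)
Lemma at_most_two_triangles x y z w u :
  D [set x; y; z] -> D [set x; y; w] -> D [set x; y; u] ->
  orient x y z != 0 -> orient x y w != 0 -> orient x y u != 0 ->
  z != w -> u = z \/ u = w.
Proof.
move=> Dz Dw Du nz nw nu zw.
have [->|uz] := eqVneq u z; first by left.
have [->|uw] := eqVneq u w; first by right.
have wz := opposite_sides Dz Dw zw nz nw.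
have wu : orient x y u / orient x y w < 0.
  by apply: opposite_sides => //; rewrite eq_sym.
have := opposite_sides Dz Du _ nz nu; rewrite eq_sym => /(_ uz).
(* The ratio for z and u is the product of two negative ratios. *)
rewrite -(divfK nw (orient x y u)) -[_ * _ / _]mulrA.
by rewrite nmulr_rlt0// lt_gtF.
Qed.

(** The points x and y lie strictly on one side of the line zw.  A segment
    between two of the four points can meet this line only in z or w, unless
    it is zw; so nothing crosses zw, and maximality of the graph applies. *)
Lemma diagonal_edge x y z w (a b c : R) :
  P = [set x; y; z; w] -> orient x y z != 0 ->
  a + b + c = 1 -> w = a *: x + b *: y + c *: z -> a < 0 -> 0 < b ->
  edge D z w.
Proof.
move=> PE nz s we a0 b0.
pose k := orient x y z.
(* Signed area over zw, scaled so that its values at x and y are the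
   coordinates - b and a. *)
pose psi v := orient z w v / k.
have psi_aff t e f : psi ((1 - t) *: e + t *: f) = (1 - t) * psi e + t * psi f.
  by rewrite /psi /orient !mxE; ring.
have psix : psi x = - b.
  rewrite /psi (_ : orient z w x = - b * k) ?mulfK//.
  by rewrite -2!orient_rot we orient_affine// /k /orient; ring.
have psiy : psi y = a.
  rewrite /psi (_ : orient z w y = a * k) ?mulfK//.
  by rewrite -2!orient_rot we orient_affine// /k /orient; ring.
have psiz : psi z = 0 by rewrite /psi /orient; ring.
have psiw : psi w = 0 by rewrite /psi /orient; ring.
have zw : z != w.
  apply/negP => /eqP zw; move: psiy; rewrite /psi zw /orient !subrr.
  by rewrite !mul0r subr0 mul0r => a00; rewrite -a00 ltxx in a0.
have Pz : P z by rewrite PE /=; tauto.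
have Pw : P w by rewrite PE /=; tauto.
apply: contrapT => nedge; apply: (nedge).
case: triPD => _ _ + _; apply => // e f ef v [[t t01 vt] [t' /andP[t0 t1] vt']].
have psiv : psi v = 0 by rewrite vt psi_aff psiz psiw; ring.
move: psiv; rewrite vt' psi_aff => psiv.
have psiP p : P p -> psi p < 0 \/ (psi p = 0 /\ (p = z \/ p = w)).
  rewrite PE => -[[[]|]|] ->; rewrite ?psix ?psiy ?psiz ?psiw; try tauto.
  by left; lra.
have [ne Pe Pf] := edge_vertices ef.
have [e0|[e0 ee]] := psiP e Pe; have [f0|[f0 fe]] := psiP f Pf.
- by exfalso; clear -psiv e0 f0 t0 t1; nra.
- move/eqP: psiv; rewrite f0 mulr0 addr0 mulf_eq0 (lt_eqF e0) orbF subr_eq0.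
  by move=> /eqP <-; rewrite subrr scale0r add0r scale1r; split=> /=; tauto.
- move/eqP: psiv; rewrite e0 mulr0 add0r mulf_eq0 (lt_eqF f0) orbF.
  by move=> /eqP ->; rewrite subr0 scale0r addr0 scale1r; split=> /=; tauto.
- exfalso; case: ee fe ef ne => -> [] ->; rewrite ?eqxx// => ef _.
  by apply: nedge; exact: edge_sym.
Qed.

(** Since b y = w - a x - c z, the signs put y inside the triangle xzw, of
    which xyz and xyw leave out the piece yzw.  Its sides are edges, and x,
    being on the other side of the line yz than w, is not in it. *)
Lemma ear_triangle x y z w (a b c : R) :
  P = [set x; y; z; w] -> D [set x; y; z] -> D [set x; y; w] ->
  orient x y z != 0 -> orient x y w != 0 ->
  a + b + c = 1 -> w = a *: x + b *: y + c *: z -> a < 0 -> c < 0 ->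
  D [set y; z; w].
Proof.
move=> PE Dz Dw nz nw s we a0 c0.
have zw : edge D z w by apply: (diagonal_edge PE nz s we) => //; clear -s a0 c0; lra.
have [_ yz _] := triangulation_edges Dz nz.
have [_ yw _] := triangulation_edges Dw nw.
case: triPD => _ _ _ /(_ y z w yz zw (edge_sym yw)) [_]; apply.
move=> v [+ hv]; rewrite PE => -[[[]|]|] ve; rewrite ve /=; try tauto.
(* If x were in yzw, its coordinate f on w would be nonnegative; the signed
   area over yz gives f * a = 1, whereas a < 0. *)
case/conv_hull3P: hv => d [e [f [d0 e0 f0 def]]]; rewrite ve => xe.
exfalso; move: (orient_affine y z y z w def); rewrite -xe.
have := orient_affine y z x y z s; rewrite -we => ->.
rewrite orient_id (_ : orient y z y = 0); last by rewrite /orient; ring.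
rewrite !mulr0 !addr0 add0r orient_rot => /eqP.
rewrite mulrA -{1}[orient _ _ _]mul1r (inj_eq (mulIf nz)) => /eqP.
by clear -a0 f0; nra.
Qed.

Lemma carrier_sub_conv_hull : carrier D `<=` conv_hull P.
Proof.
case: triPD => <- _ _ _ v [T DT Tv].
by apply: conv_hull_sub Tv => u Tu; exists T.
Qed.

(** Each triangle produced by the exchange along w = a x + b y + c z belongs
    to D: those omitting z and w by assumption, those omitting x and y as ears,
    since they occur only for a < 0 and for b < 0. *)
Lemma two_triangles_cover x y z w :
  P = [set x; y; z; w] -> D [set x; y; z] -> D [set x; y; w] -> z != w ->
  orient x y z != 0 -> orient x y w != 0 -> conv_hull P `<=` carrier D.
Proof.
move=> PE Dz Dw zw nz nw v.
have [a [b [c [s ce we]]]] := orient_barycentric w nz.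
have c0 : c < 0 by rewrite ce; exact: opposite_sides.
rewrite PE -range_tuple4 => hv.
have := @conv_hull_exchange _ _ (tnth [tuple x; y; z; w])
  (tnth [tuple - a; - b; - c; 1]) ord_max v.
rewrite !big_ord_recl !big_ord0 !(tnth_nth 0) /= addr0.
move=> /(_ _ _ _ hv) [|||]; first by clear -s; lra.
- by rewrite scale1r addr0 !scaleNr !addrA -!opprD -we addNr.
- by rewrite ltr01.
have yxP u : [set y; x; u] = [set x; y; u].
  by apply/seteqP; split => t /=; tauto.
move=> [[|[|[|[|//]]]] i4]; rewrite (tnth_nth 0) /= => li {}hv.
- exists [set y; z; w].
    by apply: (ear_triangle PE Dz Dw nz nw s we) => //; rewrite -oppr_gt0.
  apply: conv_hull_sub hv => u [[[|[|[|[|//]]]] j4] /= ji <-];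
  by rewrite (tnth_nth 0) /=; try tauto; case: ji; apply/val_inj.
- exists [set x; z; w].
    apply: (@ear_triangle y x z w b a c); rewrite ?yxP//.
    + by rewrite orientC oppr_eq0.
    + by rewrite orientC oppr_eq0.
    + by rewrite [b + a]addrC.
    + by rewrite [b *: _ + _]addrC.
    + by rewrite -oppr_gt0.
  apply: conv_hull_sub hv => u [[[|[|[|[|//]]]] j4] /= ji <-];
  by rewrite (tnth_nth 0) /=; try tauto; case: ji; apply/val_inj.
- exists [set x; y; w] => //.
  apply: conv_hull_sub hv => u [[[|[|[|[|//]]]] j4] /= ji <-];
  by rewrite (tnth_nth 0) /=; try tauto; case: ji; apply/val_inj.
- exists [set x; y; z] => //.
  apply: conv_hull_sub hv => u [[[|[|[|[|//]]]] j4] /= ji <-];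
  by rewrite (tnth_nth 0) /=; try tauto; case: ji; apply/val_inj.
Qed.

(** * Regions of pairwise strongly near triangles *)

Hypothesis nondegD : forall T, D T -> nondegenerate T.
Hypothesis nearD : forall T1 T2, D T1 -> D T2 -> strongly_near T1 T2.

(** A triangle T with a further vertex u has only two other vertices, and it
    shares two with each of xyz and xyw; these are therefore x and y. *)
Lemma at_most_four_vertices x y z w :
  D [set x; y; z] -> D [set x; y; w] -> z != w ->
  orient x y z != 0 -> orient x y w != 0 -> P = [set x; y; z; w].
Proof.
move=> Dz Dw zw nz nw; have [xy yz zx] := orient_neq nz.
have Pvert : vertices D = P by case: triPD.
apply/seteqP; split=> u; rewrite -Pvert; last first.
  by move=> [[[]|]|] ->;
    [exists [set x; y; z]|exists [set x; y; z]|exists [set x; y; z]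
    |exists [set x; y; w]] => //=; tauto.
move=> [T DT Tu]; apply: contrapT => nu.
have [e1 [e2 [[e12 Te1 Te2] [_ e1z e2z]]]] := nearD DT Dz.
have [f1 [f2 [[f12 Tf1 Tf2] [_ f1w f2w]]]] := nearD DT Dw.
have [t TE nt] := nondegenerate_third (nondegD DT) e12 Te1 Te2.
have ut : u = t.
  move: Tu; rewrite TE => -[[]|//] ue; case: nu; rewrite ue /=.
  - by move: e1z => /=; tauto.
  - by move: e2z => /=; tauto.
have eP e : [set x; y; z] e -> e = f1 \/ e = f2 -> e = x \/ e = y.
  move=> ez ef; have : [set x; y; w] e by case: ef => ->.
  case: ez => [[]|] ->; [by left|by right|] => -[[]|] zE; [by left|by right|].
  by rewrite zE eqxx in zw.
have fe f : [set x; y; w] f -> T f -> f = e1 \/ f = e2.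
  rewrite TE => fw [[]|] fE; [by left|by right|].
  by case: nu; rewrite ut -fE /=; move: fw => /=; tauto.
have ef : [/\ e1 = f1 \/ e1 = f2 & e2 = f1 \/ e2 = f2].
  have [] := (fe _ f1w Tf1, fe _ f2w Tf2) => -[] f1e [] f2e;
  by move: f12; rewrite f1e f2e ?eqxx //; split; tauto.
have {}TE : T = [set x; y; u].
  rewrite TE -ut; case: ef => /(eP _ e1z) e1E /(eP _ e2z) e2E.
  case: e1E e2E e12 => -> [] ->; rewrite ?eqxx // => _.
  by apply/seteqP; split=> v /=; tauto.
have nxyu : orient x y u != 0.
  have Tx : T x by rewrite TE /=; tauto.
  have Ty : T y by rewrite TE /=; tauto.
  have [t' TE' nt'] := nondegenerate_third (nondegD DT) xy Tx Ty.
  suff -> : u = t' by [].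
  have : [set x; y; t'] u by rewrite -TE' TE; right.
  by move=> [[]|//] uE; case: nu; rewrite uE /=; tauto.
have := at_most_two_triangles Dz Dw _ nz nw nxyu zw.
by rewrite -TE => /(_ DT) [] uE; apply: nu; rewrite uE /=; tauto.
Qed.

(** Two distinct triangles of D share an edge xy, so that
    [at_most_four_vertices] and [two_triangles_cover] apply. *)
Lemma carrier_eq_conv_hull : D !=set0 -> carrier D = conv_hull P.
Proof.
move=> [T0 DT0]; apply/seteqP; split; first exact: carrier_sub_conv_hull.
have [D1|] := pselect (forall T, D T -> T = T0).
  case: triPD => <- _ _ _ v hv; exists T0 => //.
  by apply: conv_hull_sub hv => u [T /D1 ->].
move=> /existsNP[T1 /not_implyP[DT1 T10]].
have [x [y [[xy x0 y0] [_ x1 y1]]]] := nearD DT0 DT1.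
have [z T0E nz] := nondegenerate_third (nondegD DT0) xy x0 y0.
have [w T1E nw] := nondegenerate_third (nondegD DT1) xy x1 y1.
rewrite T0E in DT0; rewrite T1E in DT1.
have zw : z != w by apply/eqP => zw; apply: T10; rewrite T0E T1E zw.
apply: (two_triangles_cover _ DT0 DT1 zw nz nw).
exact: at_most_four_vertices.
Qed.

End Triangulation.

(** The finite vertex set of the triangulation spans the polygon, and any
    triangle of the region provides three noncollinear points in it. *)
Lemma delaunay_region_convex_polygon (R : realType) (S : set (point R))
    (D : set (set (point R))) :
  delaunay_region S D -> vertices D !=set0 -> convex_polygon (carrier D).
Proof.
move=> [DS near [P finP triPD]] [v [T0 DT0 _]].
have nondeg T : D T -> nondegenerate T.
  move=> /DS[p [q [r [-> pqr _ _ _]]]]; exists p, q, r.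
  by split=> //; apply/noncollinearE.
rewrite (carrier_eq_conv_hull triPD nondeg near); last by exists T0.
split; first exact: convex_conv_hull.
exists P; split=> //; case: triPD => <- _ _ _.
have [p [q [r [T0E pqr]]]] := nondeg _ DT0.
exists p, q, r; split; last exact/noncollinearE.
- by exists T0; rewrite // T0E /=; tauto.
- by exists T0; rewrite // T0E /=; tauto.
- by exists T0; rewrite // T0E /=; tauto.
Qed.

Theorem theorem3p5 (R : realType) (S : set 'rV[R]_2)
    (D1 D2 : set (set 'rV[R]_2)) :
  finite_set S ->
  delaunay_region S D1 -> delaunay_region S D2 -> proximal D1 D2 ->
  convex_polygon (carrier D1) /\ convex_polygon (carrier D2).
Proof.
move=> _ region1 region2 [v [v1 v2]].
by split; apply: delaunay_region_convex_polygon; eauto; exists v.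
Qed.
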